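(* Let $\frac XG$ and $\frac YH$ be any pair of 0-cells in $\mathbb S$. Let $\iota^{(G)}\colon G\to G\times H$, $g\mapsto(g,e)$, and $\iota^{(H)}\colon H\to G\times H$, $h\mapsto(e,h)$, and let $$\upsilon_X\colon X\to \mathrm{Ind}_{\iota^{(G)}}X\amalg\mathrm{Ind}_{\iota^{(H)}}Y,\ x\mapsto[e,x]\in\mathrm{Ind}_{\iota^{(G)}}X,\qquad \upsilon_Y\colon Y\to \mathrm{Ind}_{\iota^{(G)}}X\amalg\mathrm{Ind}_{\iota^{(H)}}Y,\ y\mapsto[e,y]\in\mathrm{Ind}_{\iota^{(H)}}Y$$ be the natural maps. Then $$\frac XG\xrightarrow{\ \frac{\upsilon_X}{\iota^{(G)}}\ }\frac{\mathrm{Ind}_{\iota^{(G)}}X\amalg\mathrm{Ind}_{\iota^{(H)}}Y}{G\times H}\xleftarrow{\ \frac{\upsilon_Y}{\iota^{(H)}}\ }\frac YH$$ is a bicoproduct of $\frac XG$ and $\frac YH$ in $\mathbb S$.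
   Context: All groups and group-sets are finite; $e$ denotes the unit of a group. **The 2-category $\mathbb S$.** A 0-cell is a pair $\frac XG$ of a finite group $G$ and a finite left $G$-set $X$. A 1-cell $\alpha=\frac{\alpha}{\theta_\alpha}\colon \frac XG\to\frac YH$ is a map $\alpha\colon X\to Y$ together with a family $\theta_\alpha=\{\theta_{\alpha,x}\colon G\to H\}_{x\in X}$ of maps such that $\alpha(gx)=\theta_{\alpha,x}(g)\alpha(x)$ and $\theta_{\alpha,x}(gg')=\theta_{\alpha,g'x}(g)\,\theta_{\alpha,x}(g')$ for all $x\in X$, $g,g'\in G$. The composite $\beta\circ\alpha$ is the composite of maps with $\theta_{\beta\circ\alpha,x}=\theta_{\beta,\alpha(x)}\circ\theta_{\alpha,x}$; the identity has $\theta_x=\mathrm{id}_G$. A 2-cell $\varepsilon\colon\alpha\Rightarrow\alpha'$ between 1-cells $\alpha,\alpha'\colon\frac XG\to\frac YH$ is a map $X\to H$, $x\mapsto\varepsilon_x$, with $\alpha'(x)=\varepsilon_x\alpha(x)$ and $\varepsilon_{gx}\theta_{\alpha,x}(g)\varepsilon_x^{-1}=\theta_{\alpha',x}(g)$. Vertical composition: $(\varepsilon'\cdot\varepsilon)_x=\varepsilon'_x\varepsilon_x$; all 2-cells are invertible. Whiskering: $(\beta\circ\varepsilon)_x=\theta_{\beta,\alpha(x)}(\varepsilon_x)$ and $(\delta\circ\alpha)_x=\delta_{\alpha(x)}$. For a group homomorphism $f\colon G\to H$, $\frac{\alpha}{f}$ denotes a 1-cell with $\theta_{\alpha,x}=f$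 for all $x$. **Induction.** For a monomorphism of groups $\iota\colon H\hookrightarrow G$ and an $H$-set $X$, $\mathrm{Ind}_\iota X=(G\times X)/\sim$, where $(\xi,x)\sim(\xi',x')$ iff there is $h\in H$ with $x'=hx$ and $\xi=\xi'\iota(h)$; the class of $(\xi,x)$ is $[\xi,x]$ and $g[\xi,x]=[g\xi,x]$. **Bicoproducts.** In a 2-category $\mathbb C$ with invertible 2-cells, a bicoproduct of $A_1,A_2$ is a 0-cell $A_1\amalg A_2$ with 1-cells $\iota_i\colon A_i\to A_1\amalg A_2$ such that: (i) for any 1-cells $f_i\colon A_i\to X$ there are a 1-cell $f\colon A_1\amalg A_2\to X$ and 2-cells $\xi_i\colon f\circ\iota_i\Rightarrow f_i$ ($i=1,2$); (ii) for any two such triples $(f,\xi_1,\xi_2)$, $(f',\xi_1',\xi_2')$ there is a unique 2-cell $\eta\colon f\Rightarrow f'$ with $\xi_i'\cdot(\eta\circ\iota_i)=\xi_i$ ($i=1,2$). *)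

(* Defs.v *)
From HB Require Import structures.
From mathcomp Require Import all_boot all_fingroup.
From Stdlib Require Import FunctionalExtensionality.

Set Implicit Arguments.
Unset Strict Implicit.
Unset Printing Implicit Defensive.

Import GroupScope.
Local Open Scope quotient_scope.

Definition cast2 (T : Type) (R : T -> T -> Type) (f f' g g' : T)
    (p : f = f') (q : g = g') (e : R f g) : R f' g' :=
  eq_rect g (R f') (eq_rect f (fun t => R t g) e f' p) g' q.

(* Strict 2-categories all of whose 2-cells are invertible.  Horizontal
   composition is given by the two whiskerings; associativity and unitality of
   1-cells are equalities, along which 2-cells are transported by [cast2]. *)
Record category21 := Category21 {
  cell0 :> Type;
  cell1 : cell0 -> cell0 -> Type;
  cell2 : forall A B : cell0, cell1 A B -> cell1 A B -> Type;
  id1 : forall A, cell1 A A;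
  comp1 : forall A B C, cell1 B C -> cell1 A B -> cell1 A C;
  id2 : forall A B (f : cell1 A B), cell2 f f;
  vcomp : forall A B (f f' f'' : cell1 A B),
    cell2 f' f'' -> cell2 f f' -> cell2 f f'';
  inv2 : forall A B (f f' : cell1 A B), cell2 f f' -> cell2 f' f;
  whiskl : forall A B C (b : cell1 B C) (f f' : cell1 A B),
    cell2 f f' -> cell2 (comp1 b f) (comp1 b f');
  whiskr : forall A B C (b b' : cell1 B C),
    cell2 b b' -> forall f : cell1 A B, cell2 (comp1 b f) (comp1 b' f);

  comp1A : forall A B C D (c : cell1 C D) (b : cell1 B C) (a : cell1 A B),
    comp1 c (comp1 b a) = comp1 (comp1 c b) a;
  comp1_idl : forall A B (f : cell1 A B), comp1 (id1 B) f = f;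
  comp1_idr : forall A B (f : cell1 A B), comp1 f (id1 A) = f;

  vcompA : forall A B (f1 f2 f3 f4 : cell1 A B)
      (w : cell2 f3 f4) (v : cell2 f2 f3) (u : cell2 f1 f2),
    vcomp w (vcomp v u) = vcomp (vcomp w v) u;
  vcomp_idl : forall A B (f f' : cell1 A B) (u : cell2 f f'),
    vcomp (id2 f') u = u;
  vcomp_idr : forall A B (f f' : cell1 A B) (u : cell2 f f'),
    vcomp u (id2 f) = u;
  vcomp_invl : forall A B (f f' : cell1 A B) (u : cell2 f f'),
    vcomp (inv2 u) u = id2 f;
  vcomp_invr : forall A B (f f' : cell1 A B) (u : cell2 f f'),
    vcomp u (inv2 u) = id2 f';

  whiskl_id2 : forall A B C (b : cell1 B C) (f : cell1 A B),
    whiskl b (id2 f) = id2 (comp1 b f);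
  whiskl_vcomp : forall A B C (b : cell1 B C) (f f' f'' : cell1 A B)
      (v : cell2 f' f'') (u : cell2 f f'),
    whiskl b (vcomp v u) = vcomp (whiskl b v) (whiskl b u);
  whiskr_id2 : forall A B C (b : cell1 B C) (f : cell1 A B),
    whiskr (id2 b) f = id2 (comp1 b f);
  whiskr_vcomp : forall A B C (b b' b'' : cell1 B C)
      (v : cell2 b' b'') (u : cell2 b b') (f : cell1 A B),
    whiskr (vcomp v u) f = vcomp (whiskr v f) (whiskr u f);
  interchange : forall A B C (b b' : cell1 B C) (f f' : cell1 A B)
      (v : cell2 b b') (u : cell2 f f'),
    vcomp (whiskr v f') (whiskl b u) = vcomp (whiskl b' u) (whiskr v f);

  whiskl_id1 : forall A B (f f' : cell1 A B) (u : cell2 f f'),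
    cast2 (comp1_idl f) (comp1_idl f') (whiskl (id1 B) u) = u;
  whiskr_id1 : forall A B (f f' : cell1 A B) (u : cell2 f f'),
    cast2 (comp1_idr f) (comp1_idr f') (whiskr u (id1 A)) = u;
  whiskl_comp1 : forall A B C D (c : cell1 C D) (b : cell1 B C)
      (f f' : cell1 A B) (u : cell2 f f'),
    cast2 (comp1A c b f) (comp1A c b f') (whiskl c (whiskl b u))
      = whiskl (comp1 c b) u;
  whiskr_comp1 : forall A B C D (c c' : cell1 C D) (u : cell2 c c')
      (b : cell1 B C) (f : cell1 A B),
    cast2 (comp1A c b f) (comp1A c' b f) (whiskr u (comp1 b f))
      = whiskr (whiskr u b) f;
  whisklr : forall A B C D (c : cell1 C D) (b b' : cell1 B C)
      (u : cell2 b b') (f : cell1 A B),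
    cast2 (comp1A c b f) (comp1A c b' f) (whiskl c (whiskr u f))
      = whiskr (whiskl c u) f
}.

Notation "b \o1 f" := (comp1 b f) (at level 50, left associativity).
Notation "f ==>2 f'" := (cell2 f f') (at level 70, no associativity).
Notation "v \v u" := (vcomp v u) (at level 50, left associativity).

Section Bicoproduct.
Variables (C : category21) (A1 A2 P : C) (i1 : cell1 A1 P) (i2 : cell1 A2 P).

Record bicoprod_fact (Z : C) (f1 : cell1 A1 Z) (f2 : cell1 A2 Z) :=
  BicoprodFact {
    fact_map : cell1 P Z;
    fact_cell1 : fact_map \o1 i1 ==>2 f1;
    fact_cell2 : fact_map \o1 i2 ==>2 f2
  }.

Definition is_bicoproduct : Prop :=
  (forall (Z : C) (f1 : cell1 A1 Z) (f2 : cell1 A2 Z),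
     inhabited (bicoprod_fact f1 f2)) /\
  (forall (Z : C) (f1 : cell1 A1 Z) (f2 : cell1 A2 Z)
          (t t' : bicoprod_fact f1 f2),
     exists! eta : fact_map t ==>2 fact_map t',
       fact_cell1 t' \v whiskr eta i1 = fact_cell1 t /\
       fact_cell2 t' \v whiskr eta i2 = fact_cell2 t).

End Bicoproduct.

(* Left actions of a whole finite group; the library's [{action _ &-> _}] are
   right actions. *)
Record gset (G : finGroupType) := GSet {
  gset_car :> finType;
  gact : G -> gset_car -> gset_car;
  gact1 : forall x, gact 1 x = x;
  gactM : forall g h x, gact (g * h) x = gact g (gact h x)
}.

Notation "g ** x" := (gact g x) (at level 38, right associativity).

Section GSetSum.
Variables (G : finGroupType) (X Y : gset G).

Definition gsum_act (g : G) (z : (X + Y)%type) : (X + Y)%type :=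
  match z with inl x => inl (g ** x) | inr y => inr (g ** y) end.

Lemma gsum_act1 z : gsum_act 1 z = z.
Proof. by case: z => z /=; rewrite gact1. Qed.

Lemma gsum_actM g h z : gsum_act (g * h) z = gsum_act g (gsum_act h z).
Proof. by case: z => z /=; rewrite gactM. Qed.

Definition gset_sum : gset G := GSet gsum_act1 gsum_actM.

End GSetSum.

Section Induction.
(* Meant for injective [iota], such as [pairg1] and [pair1g] (see [injm_pairg1]
   and [injm_pair1g]); injectivity plays no role in the construction. *)
Variables (H G : finGroupType) (iota : {morphism [set: H] >-> G}) (X : gset H).

Definition ind_rel : rel (G * X)%type := fun p p' =>
  [exists h : H, (p'.2 == h ** p.2) && (p.1 == p'.1 * iota h)].

Lemma ind_rel_refl : reflexive ind_rel.
Proof.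
by move=> p; apply/existsP; exists 1; rewrite gact1 morph1 mulg1 !eqxx.
Qed.

Lemma ind_rel_imp_sym p p' : ind_rel p p' -> ind_rel p' p.
Proof.
case/existsP=> h /andP[/eqP e2 /eqP e1]; apply/existsP; exists h^-1.
by rewrite e2 e1 -gactM mulVg gact1 -mulgA -morphM ?inE // mulgV morph1 mulg1
           !eqxx.
Qed.

Lemma ind_rel_sym : symmetric ind_rel.
Proof. by move=> p p'; apply/idP/idP; apply: ind_rel_imp_sym. Qed.

Lemma ind_rel_trans : transitive ind_rel.
Proof.
move=> q p r /existsP[h /andP[/eqP e2 /eqP e1]].
case/existsP=> k /andP[/eqP f2 /eqP f1]; apply/existsP; exists (k * h).
by rewrite f2 e2 e1 f1 gactM morphM ?inE // mulgA !eqxx.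
Qed.

Canonical ind_equiv := EquivRel ind_rel ind_rel_refl ind_rel_sym ind_rel_trans.

Definition ind_quot := {eq_quot ind_rel}.

HB.instance Definition _ := EqQuotient.on ind_quot.
HB.instance Definition _ := Countable.on ind_quot.

Lemma ind_enumP :
  Finite.axiom (undup [seq \pi_ind_quot p | p <- enum {: G * X}]).
Proof.
move=> q; rewrite count_uniq_mem ?undup_uniq // mem_undup; apply/eqP.
by rewrite eqb1 -(reprK q) map_f // mem_enum.
Qed.

HB.instance Definition _ := isFinite.Build ind_quot ind_enumP.

Definition ind_class (xi : G) (x : X) : ind_quot := \pi_ind_quot (xi, x).

Lemma ind_classP (xi xi' : G) (x x' : X) :
  ind_class xi x = ind_class xi' x' <->
  exists h : H, x' = h ** x /\ xi = xi' * iota h.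
Proof.
split=> [/eqmodP /existsP[h /andP[/eqP e2 /eqP e1]] | [h [e2 e1]]].
  by exists h.
by apply/eqmodP/existsP; exists h; rewrite /= -e2 -e1 !eqxx.
Qed.

Definition ind_act (g : G) (q : ind_quot) : ind_quot :=
  ind_class (g * (generic_quotient.repr q).1) (generic_quotient.repr q).2.

Lemma ind_actE g xi x : ind_act g (ind_class xi x) = ind_class (g * xi) x.
Proof.
rewrite /ind_act; set q := ind_class xi x.
have: ind_class (generic_quotient.repr q).1 (generic_quotient.repr q).2 = ind_class xi x.
  by rewrite /ind_class -surjective_pairing reprK.
case/ind_classP=> h [e2 e1]; apply/ind_classP; exists h; split=> //.
by rewrite e1 mulgA.
Qed.

Lemma ind_quotP (q : ind_quot) : exists xi x, q = ind_class xi x.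
Proof.
exists (generic_quotient.repr q).1, (generic_quotient.repr q).2.
by rewrite /ind_class -surjective_pairing reprK.
Qed.

Lemma ind_act1 q : ind_act 1 q = q.
Proof. by have [xi [x ->]] := ind_quotP q; rewrite ind_actE mul1g. Qed.

Lemma ind_actM g h q : ind_act (g * h) q = ind_act g (ind_act h q).
Proof. by have [xi [x ->]] := ind_quotP q; rewrite !ind_actE mulgA. Qed.

Definition Ind : gset G := GSet ind_act1 ind_actM.

End Induction.

Record ggset := GGSet {
  ggrp : finGroupType;
  gset_of : gset ggrp
}.

Arguments GGSet {ggrp} gset_of.
Notation "[ 'ggset' X 'over' G ]" := (@GGSet G X) (at level 0).

Record gmap (A B : ggset) := GMap {
  gfun :> gset_of A -> gset_of B;
  theta : gset_of A -> ggrp A -> ggrp B;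
  gfunM : forall g x, gfun (g ** x) = theta x g ** gfun x;
  thetaM : forall g g' x,
    theta x (g * g') = theta (g' ** x) g * theta x g'
}.

Record gcell (A B : ggset) (a a' : gmap A B) := GCell {
  gcell_fun :> gset_of A -> ggrp B;
  gcellP : forall x, a' x = gcell_fun x ** a x;
  gcell_theta : forall g x,
    gcell_fun (g ** x) * theta a x g * (gcell_fun x)^-1 = theta a' x g
}.

Section Extensionality.

Lemma prop_forall_irr (T : Type) (P : T -> Prop) :
  (forall x (p q : P x), p = q) -> forall p q : (forall x, P x), p = q.
Proof.
by move=> irr p q; apply: functional_extensionality_dep => x; apply: irr.
Qed.

Lemma gmap_ext (A B : ggset) (a b : gmap A B) :
  gfun a =1 gfun b -> theta a =2 theta b -> a = b.
Proof.
case: a b => [a ta aM taM] [b tb bM tbM] /= eab etab.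
have {}eab : a = b by apply: functional_extensionality.
have {}etab : ta = tb.
  apply: functional_extensionality => x.
  by apply: functional_extensionality => g; apply: etab.
subst b tb; congr GMap.
  by do 2!apply: prop_forall_irr => ?; apply: eq_irrelevance.
by do 3!apply: prop_forall_irr => ?; apply: eq_irrelevance.
Qed.

Lemma gcell_ext (A B : ggset) (a a' : gmap A B) (u v : gcell a a') :
  u =1 v -> u = v.
Proof.
case: u v => [u u1 u2] [v v1 v2] /= euv.
have {}euv : u = v by apply: functional_extensionality.
subst v; congr GCell.
  by apply: prop_forall_irr => ?; apply: eq_irrelevance.
by do 2!apply: prop_forall_irr => ?; apply: eq_irrelevance.
Qed.

Lemma cast2_gcell (A B : ggset) (a a' b b' : gmap A B)
    (p : a = b) (q : a' = b') (u : gcell a a') :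
  cast2 (R := @gcell A B) p q u =1 u.
Proof. by case: b / p; case: b' / q. Qed.

End Extensionality.

Lemma theta1 (A B : ggset) (a : gmap A B) x : theta a x 1 = 1.
Proof.
by apply: (mulgI (theta a x 1)); rewrite -{1}(gact1 x) -thetaM !mulg1.
Qed.

Lemma thetaV (A B : ggset) (a : gmap A B) g x :
  theta a (g ** x) g^-1 = (theta a x g)^-1.
Proof. by apply: (mulIg (theta a x g)); rewrite -thetaM !mulVg theta1. Qed.

Section Operations.

Definition gmap_id (A : ggset) : gmap A A :=
  @GMap A A (fun x => x) (fun _ g => g) (fun _ _ => erefl) (fun _ _ _ => erefl).

Section Comp.
Variables (A B C : ggset) (b : gmap B C) (a : gmap A B).

Let cf x := b (a x).
Let ct x g := theta b (a x) (theta a x g).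

Lemma gmap_compM g x : cf (g ** x) = ct x g ** cf x.
Proof. by rewrite /cf !gfunM. Qed.

Lemma gmap_comp_thetaM g g' x : ct x (g * g') = ct (g' ** x) g * ct x g'.
Proof. by rewrite /ct !thetaM -gfunM. Qed.

Definition gmap_comp : gmap A C := GMap gmap_compM gmap_comp_thetaM.

End Comp.

Section Vertical.
Variables (A B : ggset).

Lemma gcell_id1 (a : gmap A B) x : a x = 1 ** a x.
Proof. by rewrite gact1. Qed.

Lemma gcell_id2 (a : gmap A B) g x : 1 * theta a x g * 1^-1 = theta a x g.
Proof. by rewrite mul1g invg1 mulg1. Qed.

Definition gcell_id (a : gmap A B) : gcell a a :=
  @GCell A B a a (fun _ => 1) (gcell_id1 a) (gcell_id2 a).

Variables (a a' a'' : gmap A B) (v : gcell a' a'') (u : gcell a a').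

Lemma gcell_vcomp1 x : a'' x = (v x * u x) ** a x.
Proof. by rewrite gactM -gcellP -gcellP. Qed.

Lemma gcell_vcomp2 g x :
  (v (g ** x) * u (g ** x)) * theta a x g * (v x * u x)^-1 = theta a'' x g.
Proof. by rewrite -(gcell_theta v) -(gcell_theta u) invMg !mulgA. Qed.

Definition gcell_vcomp : gcell a a'' :=
  @GCell A B a a'' (fun x => v x * u x) gcell_vcomp1 gcell_vcomp2.

Lemma gcell_inv1 x : a x = (u x)^-1 ** a' x.
Proof. by rewrite (gcellP u) -gactM mulVg gact1. Qed.

Lemma gcell_inv2 g x :
  (u (g ** x))^-1 * theta a' x g * ((u x)^-1)^-1 = theta a x g.
Proof. by rewrite -(gcell_theta u) invgK !mulgA mulVg mul1g mulgKV. Qed.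

Definition gcell_inv : gcell a' a :=
  @GCell A B a' a (fun x => (u x)^-1) gcell_inv1 gcell_inv2.

End Vertical.

Section Whiskerl.
Variables (A B C : ggset) (b : gmap B C) (a a' : gmap A B) (u : gcell a a').

Let wf x := theta b (a x) (u x).

Lemma gcell_whiskl1 x : gmap_comp b a' x = wf x ** gmap_comp b a x.
Proof. by rewrite /= (gcellP u) gfunM. Qed.

Lemma gcell_whiskl2 g x :
  wf (g ** x) * theta (gmap_comp b a) x g * (wf x)^-1
    = theta (gmap_comp b a') x g.
Proof.
rewrite /wf /= -(gcell_theta u) (thetaM b _ (u x)^-1) -gcell_inv1 thetaM.
by rewrite -gfunM (gcellP u) thetaV.
Qed.

Definition gcell_whiskl : gcell (gmap_comp b a) (gmap_comp b a') :=
  GCell gcell_whiskl1 gcell_whiskl2.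

End Whiskerl.

Section Whiskerr.
Variables (A B C : ggset) (b b' : gmap B C) (u : gcell b b') (a : gmap A B).

Let wf x := u (a x).

Lemma gcell_whiskr1 x : gmap_comp b' a x = wf x ** gmap_comp b a x.
Proof. exact: (gcellP u (a x)). Qed.

Lemma gcell_whiskr2 g x :
  wf (g ** x) * theta (gmap_comp b a) x g * (wf x)^-1
    = theta (gmap_comp b' a) x g.
Proof. by rewrite /wf /= gfunM gcell_theta. Qed.

Definition gcell_whiskr : gcell (gmap_comp b a) (gmap_comp b' a) :=
  GCell gcell_whiskr1 gcell_whiskr2.

End Whiskerr.

End Operations.

Lemma gmap_compA (A B C D : ggset) (c : gmap C D) (b : gmap B C)
    (a : gmap A B) :
  gmap_comp c (gmap_comp b a) = gmap_comp (gmap_comp c b) a.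
Proof. exact: gmap_ext. Qed.

Lemma gmap_comp_idl (A B : ggset) (a : gmap A B) :
  gmap_comp (gmap_id B) a = a.
Proof. exact: gmap_ext. Qed.

Lemma gmap_comp_idr (A B : ggset) (a : gmap A B) :
  gmap_comp a (gmap_id A) = a.
Proof. exact: gmap_ext. Qed.

Definition catS : category21.
Proof.
refine (@Category21 ggset gmap gcell gmap_id gmap_comp gcell_id gcell_vcomp
  gcell_inv gcell_whiskl gcell_whiskr gmap_compA gmap_comp_idl gmap_comp_idr
  _ _ _ _ _ _ _ _ _ _ _ _ _ _ _);
  intros; apply: gcell_ext => x /=; rewrite ?cast2_gcell //=.
- exact: mulgA.
- exact: mul1g.
- exact: mulg1.
- exact: mulVg.
- exact: mulgV.
- exact: theta1.
- by rewrite thetaM -gcellP.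
- by rewrite -(gcell_theta v) (gcellP u) mulgKV.
Defined.

(* The 1-cell written "a over f": theta is constantly the homomorphism f. *)
Definition gmap_of_hom (G H : finGroupType) (X : gset G) (Y : gset H)
    (f : {morphism [set: G] >-> H}) (a : X -> Y)
    (aM : forall g x, a (g ** x) = f g ** a x) :
  cell1 ([ggset X over G] : catS) ([ggset Y over H] : catS) :=
  @GMap (GGSet X) (GGSet Y) a (fun _ => f) aM
    (fun g g' _ => morphM f (in_setT g) (in_setT g')).

Arguments gmap_of_hom {G H X Y} f a aM.

Section IndSum.
Variables (G H : finGroupType) (X : gset G) (Y : gset H).

Definition iotaG : {morphism [set: G] >-> G * H} := [morphism of @pairg1 G H].
Definition iotaH : {morphism [set: H] >-> G * H} := [morphism of @pair1g G H].

Definition ind_sum : gset (G * H)%type :=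
  gset_sum (Ind iotaG X) (Ind iotaH Y).

Definition upsilonX (x : X) : ind_sum := inl (ind_class iotaG 1 x).
Definition upsilonY (y : Y) : ind_sum := inr (ind_class iotaH 1 y).

Lemma upsilonXM g x : upsilonX (g ** x) = iotaG g ** upsilonX x.
Proof.
rewrite /upsilonX /= ind_actE mulg1; congr inl.
by symmetry; apply/ind_classP; exists g; rewrite mul1g.
Qed.

Lemma upsilonYM h y : upsilonY (h ** y) = iotaH h ** upsilonY y.
Proof.
rewrite /upsilonY /= ind_actE mulg1; congr inr.
by symmetry; apply/ind_classP; exists h; rewrite mul1g.
Qed.

End IndSum.

Arguments ind_sum {G H} X Y.
Arguments upsilonX {G H} X Y x.
Arguments upsilonY {G H} X Y y.
Arguments upsilonXM {G H} X Y g x.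
Arguments upsilonYM {G H} X Y h y.

(* Main.v *)
Require Import Defs.
From mathcomp Require Import all_boot all_fingroup.

(** The cospan of the theorem factors through the cospan of the two coproduct
    inclusions of [K]-sets over the one group [K = G * H], as
      X/G --> Ind X/K --> (Ind X + Ind Y)/K <-- Ind Y/K <-- Y/H.
    Two facts then give the result.

    Over a fixed group a coproduct of sets is a strict coproduct: a 1-cell, or a
    2-cell, out of [(U + V)/K] is exactly a pair of 1-cells, or 2-cells, out of
    [U/K] and [V/K], because all the structure is indexed by points of the
    source and the action never mixes the two summands ([gmap_copair],
    [gcell_copair]).

    The unit [X/G --> Ind X/K], [x |-> [1, x]], is an equivalence; it enters
    through the equivalent property [precomp_equiv], that precomposition with it
    is an equivalence of hom-categories.  Every point of [Ind X] is a translate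
    [xi ** [1, x]], so the compatibility of a 2-cell with the action both
    determines it from its values at the points [[1, x]] and says how to extend
    it from them ([precomp_fully_faithful_ind_unit]).  That 1-cells extend is
    easy here because the inclusion of [G] in [G * H] has a retraction [p]: the
    unit itself is then split by the 1-cell [[xi, x] |-> p xi ** x] over [p]
    ([ind_retractK]).

    A coproduct remains a bicoproduct when its inclusions are precomposed with
    such equivalences ([bicoproduct_gset_sum]). *)

Set Implicit Arguments.
Unset Strict Implicit.
Unset Printing Implicit Defensive.

Import GroupScope.

(** * Equivalences through their precomposition functors *)

Definition precomp_fully_faithful (A B : ggset) (u : gmap A B) : Prop :=
  forall (Z : ggset) (a a' : gmap B Z)
         (e : gcell (gmap_comp a u) (gmap_comp a' u)),
    exists! eta : gcell a a', gcell_whiskr eta u =1 e.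

Definition precomp_ess_surj (A B : ggset) (u : gmap A B) : Prop :=
  forall (Z : ggset) (f : gmap A Z),
    exists F : gmap B Z, inhabited (gcell (gmap_comp F u) f).

Definition precomp_equiv (A B : ggset) (u : gmap A B) : Prop :=
  precomp_fully_faithful u /\ precomp_ess_surj u.

Lemma gcell_of_eq (A B : ggset) (a b : gmap A B) : a = b -> gcell a b.
Proof. by move=> ->; apply: gcell_id. Defined.

(** * Coproducts over a fixed group *)

Section Sum.
Variables (K : finGroupType) (U V : gset K).
Implicit Type Z : ggset.

Let S : ggset := GGSet (gset_sum U V).

Definition sum_inl : gmap (GGSet U) S :=
  @GMap (GGSet U) S inl (fun _ k => k) (fun _ _ => erefl) (fun _ _ _ => erefl).

Definition sum_inr : gmap (GGSet V) S :=
  @GMap (GGSet V) S inr (fun _ k => k) (fun _ _ => erefl) (fun _ _ _ => erefl).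

Section Copair.
Variables (Z : ggset) (f : gmap (GGSet U) Z) (g : gmap (GGSet V) Z).

Definition copair_fun (s : gset_of S) : gset_of Z :=
  match s with inl x => f x | inr y => g y end.

Definition copair_theta (s : gset_of S) : K -> ggrp Z :=
  match s with inl x => theta f x | inr y => theta g y end.

Lemma copair_funM k s : copair_fun (k ** s) = copair_theta s k ** copair_fun s.
Proof. by case: s => s; apply: gfunM. Qed.

Lemma copair_thetaM k k' s :
  copair_theta s (k * k') = copair_theta (k' ** s) k * copair_theta s k'.
Proof. by case: s => s; apply: thetaM. Qed.

Definition gmap_copair : gmap S Z := @GMap S Z _ _ copair_funM copair_thetaM.

Lemma gmap_copair_inl : gmap_comp gmap_copair sum_inl = f.
Proof. exact: gmap_ext. Qed.

Lemma gmap_copair_inr : gmap_comp gmap_copair sum_inr = g.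
Proof. exact: gmap_ext. Qed.

End Copair.

Section CellCopair.
Variables (Z : ggset) (a a' : gmap S Z).
Variables (d : gcell (gmap_comp a sum_inl) (gmap_comp a' sum_inl)).
Variables (e : gcell (gmap_comp a sum_inr) (gmap_comp a' sum_inr)).

Definition cell_copair_fun (s : gset_of S) : ggrp Z :=
  match s with inl x => d x | inr y => e y end.

Lemma cell_copairP s : a' s = cell_copair_fun s ** a s.
Proof. by case: s => s; [apply: (gcellP d) | apply: (gcellP e)]. Qed.

Lemma cell_copair_theta k s :
  cell_copair_fun (k ** s) * theta a s k * (cell_copair_fun s)^-1
    = theta a' s k.
Proof. by case: s => s; [apply: (gcell_theta d) | apply: (gcell_theta e)]. Qed.

Definition gcell_copair : gcell a a' :=
  @GCell S Z a a' _ cell_copairP cell_copair_theta.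

End CellCopair.

(** Precomposition with the inclusions is already an isomorphism of
    hom-categories onto a product, and that with [u] and [v] is an equivalence
    on each factor. *)
Lemma bicoproduct_gset_sum (A B : ggset)
    (u : gmap A (GGSet U)) (v : gmap B (GGSet V)) :
  precomp_equiv u -> precomp_equiv v ->
  @is_bicoproduct catS A B S (gmap_comp sum_inl u) (gmap_comp sum_inr v).
Proof.
move=> [uff ues] [vff ves]; split=> [Z f g | Z f g t t'].
  have [F [d]] := ues Z f; have [E [e]] := ves Z g.
  have p : gmap_comp (gmap_copair F E) (gmap_comp sum_inl u) = gmap_comp F u.
    by rewrite gmap_compA gmap_copair_inl.
  have q : gmap_comp (gmap_copair F E) (gmap_comp sum_inr v) = gmap_comp E v.
    by rewrite gmap_compA gmap_copair_inr.
  split; apply: (@BicoprodFact catS A B S _ _ Z f g (gmap_copair F E)).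
    exact: gcell_vcomp d (gcell_of_eq p).
  exact: gcell_vcomp e (gcell_of_eq q).
case: t => a d e; case: t' => a' d' e' /=.
rewrite /= in a d e a' d' e' *.
(* The two equations ask for the restrictions of [eta] along the inclusions to
   be [d'^-1 * d] and [e'^-1 * e]; reassociating the composites exhibits these
   as restrictions along [u] and [v] of 2-cells on the summands. *)
have [du [duE du_uniq]] := uff Z _ _
  (cast2 (gmap_compA _ _ _) (gmap_compA _ _ _) (gcell_vcomp (gcell_inv d') d)).
have [ev [evE ev_uniq]] := vff Z _ _
  (cast2 (gmap_compA _ _ _) (gmap_compA _ _ _) (gcell_vcomp (gcell_inv e') e)).
exists (gcell_copair du ev); split=> [|eta [etad etae]].
  split; apply: gcell_ext => x /=.
    by have /= -> := duE x; rewrite cast2_gcell /= mulKVg.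
  by have /= -> := evE x; rewrite cast2_gcell /= mulKVg.
apply: gcell_ext => -[x|y] /=.
  rewrite (du_uniq (gcell_whiskr eta sum_inl)) // => z.
  by rewrite cast2_gcell /= -etad /= mulKg.
rewrite (ev_uniq (gcell_whiskr eta sum_inr)) // => z.
by rewrite cast2_gcell /= -etae /= mulKg.
Qed.

End Sum.

(** * The unit of induction *)

Section IndUnit.
Variables (G K : finGroupType) (iota : {morphism [set: G] >-> K}) (X : gset G).
Implicit Type Z : ggset.

Let I : ggset := GGSet (Ind iota X).
Let unit_fun (x : X) : gset_of I := ind_class iota 1 x.

Lemma ind_class_trans xi g (x : X) :
  ind_class iota (xi * iota g) x = ind_class iota xi (g ** x).
Proof. by apply/ind_classP; exists g. Qed.

Lemma ind_unit_funM g x : unit_fun (g ** x) = iota g ** unit_fun x.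
Proof. by rewrite /unit_fun /= ind_actE mulg1 -ind_class_trans mul1g. Qed.

Definition ind_unit : gmap (GGSet X) I :=
  gmap_of_hom iota unit_fun ind_unit_funM.

Lemma ind_unitM g x : ind_unit (g ** x) = iota g ** ind_unit x.
Proof. exact: gfunM. Qed.

Lemma ind_classE xi (x : X) :
  ind_class iota xi x = xi ** ind_unit x :> gset_of I.
Proof. by rewrite /= ind_actE mulg1. Qed.

Lemma ind_repr (q : gset_of I) :
  q = (generic_quotient.repr q).1 ** ind_unit (generic_quotient.repr q).2.
Proof. by rewrite -ind_classE /ind_class -surjective_pairing reprK. Qed.

Lemma ind_unit_gen (q : gset_of I) : exists xi x, q = xi ** ind_unit x.
Proof. by do 2!eexists; apply: ind_repr. Qed.

Section CellExtension.
Variables (Z : ggset) (a a' : gmap I Z).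

(** The value at [xi ** p] that the compatibility of a 2-cell with [xi] forces
    when its value at [p] is [c]. *)
Definition cell_transport (xi : K) (p : gset_of I) (c : ggrp Z) : ggrp Z :=
  theta a' p xi * c * (theta a p xi)^-1.

Lemma cell_transportE (eta : gcell a a') xi p :
  eta (xi ** p) = cell_transport xi p (eta p).
Proof. by rewrite /cell_transport -(gcell_theta eta) !mulgKV mulgK. Qed.

Lemma cell_transportM xi xi' p c :
  cell_transport (xi * xi') p c
    = cell_transport xi (xi' ** p) (cell_transport xi' p c).
Proof. by rewrite /cell_transport !thetaM invMg !mulgA. Qed.

Variable e : gcell (gmap_comp a ind_unit) (gmap_comp a' ind_unit).

Lemma cell_transport_unit g x :
  cell_transport (iota g) (ind_unit x) (e x) = e (g ** x).
Proof.
rewrite /cell_transport; have /= <- := gcell_theta e g x.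
by rewrite !mulgKV mulgK.
Qed.

Definition cell_ext_fun (q : gset_of I) : ggrp Z :=
  cell_transport (generic_quotient.repr q).1
    (ind_unit (generic_quotient.repr q).2) (e (generic_quotient.repr q).2).

(** Two expressions of a point as [xi ** [1, x]] differ by an element of the
    image of [iota], and along such elements transport agrees with [e] because
    [e] is a 2-cell ([cell_transport_unit]). *)
Lemma cell_ext_funE xi x :
  cell_ext_fun (xi ** ind_unit x) = cell_transport xi (ind_unit x) (e x).
Proof.
rewrite /cell_ext_fun; move: (ind_repr (xi ** ind_unit x)).
case: (generic_quotient.repr _) => xi' x' /=.
rewrite !ind_actE !mulg1 => /ind_classP[g [-> ->]].
have := cell_transportM xi' (iota g) (ind_unit x) (e x).
by rewrite -ind_unitM cell_transport_unit.
Qed.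

Lemma cell_ext_transport xi q :
  cell_ext_fun (xi ** q) = cell_transport xi q (cell_ext_fun q).
Proof.
have [xi' [x ->]] := ind_unit_gen q.
by rewrite -Defs.gactM !cell_ext_funE cell_transportM.
Qed.

Lemma cell_extP q : a' q = cell_ext_fun q ** a q.
Proof.
have [xi [x ->]] := ind_unit_gen q.
have /= ex := gcellP e x.
by rewrite cell_ext_funE !gfunM ex -!Defs.gactM mulgKV.
Qed.

Lemma cell_ext_theta xi q :
  cell_ext_fun (xi ** q) * theta a q xi * (cell_ext_fun q)^-1 = theta a' q xi.
Proof. by rewrite cell_ext_transport mulgKV mulgK. Qed.

Lemma cell_ext_unit x : cell_ext_fun (ind_unit x) = e x.
Proof.
have /= := cell_ext_funE 1 x; rewrite ind_act1 => ->.
by rewrite /cell_transport !theta1 mul1g invg1 mulg1.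
Qed.

Definition gcell_ext_ind : gcell a a' :=
  @GCell I Z a a' cell_ext_fun cell_extP cell_ext_theta.

End CellExtension.

(** The points [[1, x]] generate [Ind X] under the action, so transport from
    them gives both uniqueness and, once well defined, existence. *)
Lemma precomp_fully_faithful_ind_unit : precomp_fully_faithful ind_unit.
Proof.
move=> Z a a' e; exists (gcell_ext_ind e).
split=> [x | eta etaE]; first exact: cell_ext_unit.
apply: gcell_ext => q; have [xi [x ->]] := ind_unit_gen q.
rewrite !cell_transportE (etaE x : eta (ind_unit x) = e x).
by congr cell_transport; apply: cell_ext_unit.
Qed.

Section Retraction.
Variables (p : {morphism [set: K] >-> G}) (iotaK : cancel iota p).

Definition ind_retract_fun (q : gset_of I) : X :=
  p (generic_quotient.repr q).1 ** (generic_quotient.repr q).2.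

Lemma ind_retract_funE xi x :
  ind_retract_fun (xi ** ind_unit x) = p xi ** x.
Proof.
rewrite /ind_retract_fun; move: (ind_repr (xi ** ind_unit x)).
case: (generic_quotient.repr _) => xi' x' /=.
rewrite !ind_actE !mulg1 => /ind_classP[g [-> ->]].
by rewrite morphM ?inE // iotaK Defs.gactM.
Qed.

Lemma ind_retract_funM xi q :
  ind_retract_fun (xi ** q) = p xi ** ind_retract_fun q.
Proof.
have [xi' [x ->]] := ind_unit_gen q.
by rewrite -Defs.gactM !ind_retract_funE morphM ?inE // Defs.gactM.
Qed.

Definition ind_retract : gmap I (GGSet X) :=
  gmap_of_hom p ind_retract_fun ind_retract_funM.

Lemma ind_retractK : gmap_comp ind_retract ind_unit = gmap_id (GGSet X).
Proof.
apply: gmap_ext => [x | x g] /=; last exact: iotaK.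
by have /= := ind_retract_funE 1 x; rewrite ind_act1 morph1 Defs.gact1.
Qed.

Lemma precomp_equiv_ind_unit : precomp_equiv ind_unit.
Proof.
split=> [|Z f]; first exact: precomp_fully_faithful_ind_unit.
exists (gmap_comp f ind_retract).
by rewrite -gmap_compA ind_retractK gmap_comp_idr; split; apply: gcell_id.
Qed.

End Retraction.

End IndUnit.

(** * The bicoproduct *)

Theorem proposition3p2p15 (G H : finGroupType) (X : gset G) (Y : gset H) :
  @is_bicoproduct catS
    [ggset X over G] [ggset Y over H] [ggset (ind_sum X Y) over (G * H)%type]
    (gmap_of_hom (iotaG G H) (upsilonX X Y) (upsilonXM X Y))
    (gmap_of_hom (iotaH G H) (upsilonY X Y) (upsilonYM X Y)).
Proof.
have -> : gmap_of_hom (iotaG G H) (upsilonX X Y) (upsilonXM X Y)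
    = gmap_comp (sum_inl _ _) (ind_unit (iotaG G H) X).
  exact: gmap_ext.
have -> : gmap_of_hom (iotaH G H) (upsilonY X Y) (upsilonYM X Y)
    = gmap_comp (sum_inr _ _) (ind_unit (iotaH G H) Y).
  exact: gmap_ext.
apply: bicoproduct_gset_sum.
  exact: (@precomp_equiv_ind_unit _ _ _ _ [morphism of @fst G H]).
exact: (@precomp_equiv_ind_unit _ _ _ _ [morphism of @snd G H]).
Qed.
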